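(* Let $a$ be an indeterminate. For every nonnegative integer $n$, $$\sum_{\lambda \in Q(n)} \omega_e(\lambda) = \begin{cases} (-a)^k, & \text{if } n = k^2 \text{ for some nonnegative integer } k,\\ 0, & \text{otherwise,}\end{cases}$$ where for $\lambda = (\lambda_1, \ldots, \lambda_l) \in Q(n)$ the weight is $\omega_e(\lambda) = (-1)^{l-1} a^{\ell_o(\lambda)}$.
   Context: $Q(n)$ denotes the set of nonempty finite strictly decreasing sequences $\lambda = (\lambda_1 > \lambda_2 > \cdots > \lambda_l)$ of nonnegative integers (so $0$ is allowed as a part, at most once) with $\lambda_1 + \cdots + \lambda_l = n$ and whose smallest part $\lambda_l$ is even. Here $l$ is the number of parts of $\lambda$ (a part equal to $0$ counts as a part), and $\ell_o(\lambda)$ is the number of odd parts of $\lambda$. *)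

(* Defs.v *)
From HB Require Import structures.
From mathcomp Require Import all_boot all_order all_algebra.

Set Implicit Arguments.
Unset Strict Implicit.
Unset Printing Implicit Defensive.

Import GRing.Theory.

(* For a strictly decreasing sequence the smallest part is the last one; the
   default value of [last] is never used since the sequence is nonempty. *)
Definition is_Q (n : nat) (l : seq nat) : bool :=
  [&& l != [::], sorted gtn l, sumn l == n & ~~ odd (last 0 l)].

Record Q (n : nat) : predArgType := MkQ { parts :> seq nat; partsP : is_Q n parts }.

HB.instance Definition _ n := [isSub for @parts n].
HB.instance Definition _ n := [Countable of Q n by <:].

(* Every element of Q(n) is the decreasing listing of a subset of {0, .., n}. *)
Definition Q_enum (n : nat) : seq (Q n) :=
  undup (pmap insub [seq rev (map val (enum A)) | A : {set 'I_n.+1}]).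

Lemma leq_sumn (l : seq nat) (x : nat) : x \in l -> x <= sumn l.
Proof.
elim: l => //= y l IH; rewrite in_cons => /orP[/eqP->|/IH h].
  exact: leq_addr.
exact: leq_trans h (leq_addl _ _).
Qed.

Lemma Q_enumP (n : nat) : Finite.axiom (Q_enum n).
Proof.
move=> l; rewrite count_uniq_mem ?undup_uniq // mem_undup mem_pmap_sub.
case: l => l Hl /=; have /and4P[_ sl /eqP sn _] := Hl.
suff -> : l \in [seq rev (map val (enum A)) | A : {set 'I_n.+1}] by [].
apply/mapP; exists [set i : 'I_n.+1 | val i \in l]; first by rewrite mem_enum.
apply: (can_inj revK); rewrite revK.
apply: (irr_sorted_eq ltn_trans ltnn); first by rewrite rev_sorted.
  rewrite sorted_map /enum_mem; apply: sorted_filter.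
    by move=> x y z /=; apply: ltn_trans.
  by rewrite -sorted_map -enumT val_enum_ord iota_ltn_sorted.
move=> x; rewrite mem_rev; apply/idP/mapP => [xl|[i]].
  have xn : x < n.+1 by rewrite ltnS -sn leq_sumn.
  by exists (Ordinal xn); rewrite // mem_enum inE.
by rewrite mem_enum inE => + ->.
Qed.

HB.instance Definition _ n := isFinite.Build (Q n) (@Q_enumP n).

Definition nb_odd_parts (l : seq nat) : nat := count odd l.

Local Open Scope ring_scope.

(* The indeterminate a is the variable 'X of Z[a]. *)
Definition omega_e (l : seq nat) : {poly int} :=
  (-1) ^+ (size l).-1 * 'X ^+ nb_odd_parts l.

(* Main.v *)
(** For the generating function
    [F(a) = \sum_m q^(2m) \prod_(j > m) (1 - q^(2j)) \prod_(j >= m) (1 - a q^(2j+1))]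
    of the weights, where [2m] is the smallest part, write
    [q^(2m) \prod_(j > m) (1 - q^(2j))] as a difference of consecutive products
    and sum by parts.  This gives [F(a) = 1 - a q F(a q^2)], and iterating
    yields [F(a) = \sum_k (-a)^k q^(k^2)].  To stay within polynomials, the parts
    are bounded by [2N], which perturbs the functional equation by a multiple
    of [q^(2N+2)] only. *)
Require Import Defs.
From mathcomp Require Import all_boot all_order all_algebra.
From mathcomp Require Import ring.

Import GRing.Theory.

Local Open Scope ring_scope.

Fixpoint decseqs (M : nat) : seq (seq nat) :=
  if M is m.+1 then decseqs m ++ [seq m :: l | l <- decseqs m] else [:: [::]].

Lemma mem_decseqs (M : nat) (l : seq nat) :
  (l \in decseqs M) = sorted gtn l && all (gtn M) l.
Proof.
elim: M l => [|M IH] l /=; first by case: l => [|x l] //=; rewrite andbF.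
rewrite mem_cat IH; case: l => [|x l] //=.
have -> : (x :: l \in [seq M :: l0 | l0 <- decseqs M])
          = (x == M) && (l \in decseqs M).
  by apply/mapP/andP => [[l0 h [-> ->]]|[/eqP-> h]]; [rewrite eqxx | exists l].
rewrite IH !(path_sortedE (rev_trans ltn_trans)) ltnS [(x <= M)%N]leq_eqVlt.
have all_lt m p : (m <= p)%N -> all (gtn m) l -> all (gtn p) l.
  by move=> mp; apply: sub_all => y /= ym; apply: leq_trans mp.
have [->|neqxM] /= := eqVneq x M.
  rewrite ltnn /= andbF /=.
  have [h|] := boolP (all (gtn M) l); last by rewrite andbF.
  by rewrite (all_lt _ _ (leqnSn M) h) !andbT.
rewrite orbF; have [xM|] := boolP (x < M)%N; last by rewrite !andbF.
have [h|] //= := boolP (all (gtn x) l).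
by rewrite (all_lt _ _ (ltnW xM) h) (all_lt _ _ (leqW (ltnW xM)) h).
Qed.

Lemma decseqs_uniq (M : nat) : uniq (decseqs M).
Proof.
elim: M => //= M IH; rewrite cat_uniq IH map_inj_uniq ?IH ?andbT; last by move=> ? ? [].
by apply/hasPn => _ /mapP[l _ ->]; rewrite mem_decseqs /= ltnn andbF.
Qed.

(** Parts of an element of [Q n] are at most [n], so any bound [M > n] loses nothing; the list
    allows recursion on the largest part. *)
Lemma sum_Q_decseqs {V : nmodType} (f : seq nat -> V) (n M : nat) :
  (n < M)%N -> \sum_(l : Q n) f l = \sum_(l <- decseqs M | is_Q n l) f l.
Proof.
move=> nM; rewrite -[LHS](big_map (@parts n) predT f) -[RHS]big_filter.
apply/perm_big/uniq_perm; rewrite ?filter_uniq ?decseqs_uniq //.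
  by rewrite map_inj_uniq ?index_enum_uniq //; apply: val_inj.
move=> l; rewrite mem_filter; apply/mapP/andP => [[[l' Ql'] _ ->]|[Ql _]] /=.
  split=> //; rewrite mem_decseqs; case/and4P: Ql' => _ -> /eqP sl' _ /=.
  by apply/allP => x /leq_sumn xl' /=; apply: leq_ltn_trans xl' _; rewrite sl'.
by exists (MkQ Ql); rewrite // mem_index_enum.
Qed.

(* [Qgen q N b] is [F(b)] restricted to the parts [< 2N], and [Qrem q N b] is
   the sum left over by the summation by parts. *)
Fixpoint Qgen {R : comNzRingType} (q : R) (N : nat) (b : R) : R :=
  if N is m.+1 then
    (1 - b * q ^+ m.*2.+1) * ((1 - q ^+ m.*2) * Qgen q m b + q ^+ m.*2)
  else 0.

Fixpoint Qrem {R : comNzRingType} (q : R) (N : nat) (b : R) : R :=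
  if N is m.+1 then
    (1 - q ^+ m.*2) * (1 - b * q ^+ m.*2.+1) * Qrem q m b + q ^+ m.*2
  else 0.

Lemma Qgen_summation_by_parts {R : comNzRingType} (q : R) (N : nat) (b : R) :
  Qgen q N.+1 b = 1 - b * q * Qrem q N.+1 b.
Proof.
elim: N => [|N IH]; first by rewrite /= expr0 expr1; ring.
have -> : Qgen q N.+2 b = (1 - b * q ^+ N.+1.*2.+1) *
  ((1 - q ^+ N.+1.*2) * Qgen q N.+1 b + q ^+ N.+1.*2) by [].
have -> : Qrem q N.+2 b = (1 - q ^+ N.+1.*2) * (1 - b * q ^+ N.+1.*2.+1) *
  Qrem q N.+1 b + q ^+ N.+1.*2 by [].
rewrite IH exprS; ring.
Qed.

(** Replacing [b] by [b * q ^+ 2] turns the odd factors of index [m <= j < N] into those of index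
    [m < j <= N]; apart from [j = N] they are the ones in [Qrem]. *)
Lemma Qgen_shift {R : comNzRingType} (q : R) (N : nat) (b : R) :
  Qgen q N (b * q ^+ 2) = (1 - b * q ^+ N.*2.+1) * Qrem q N b.
Proof.
elim: N => [|N IH] /=; first by rewrite mulr0.
rewrite IH !exprS; ring.
Qed.

(** [Qrem] is eliminated between the two previous lemmas. The boundary factor
    [1 - b * q ^+ N.+1.*2.+1] of the shift causes the last term. *)
Lemma Qgen_functional_eq {R : comNzRingType} (q : R) (N : nat) (b : R) :
  Qgen q N.+1 b = 1 - b * q * Qgen q N.+1 (b * q ^+ 2)
                  - q ^+ N.+2.*2 * (b ^+ 2 * Qrem q N.+1 b).
Proof.
rewrite Qgen_shift Qgen_summation_by_parts !doubleS !exprS; ring.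
Qed.

(** The functional equation iterated [K] times: the squares arise as sums of consecutive odd
    numbers. *)
Lemma Qgen_theta {R : comNzRingType} (q : R) (N : nat) (b : R) (K : nat) : exists r,
  Qgen q N.+1 b = \sum_(i < K) (- b) ^+ i * q ^+ (i ^ 2)
    + (- b) ^+ K * q ^+ (K ^ 2) * Qgen q N.+1 (b * q ^+ K.*2)
    + q ^+ N.+2.*2 * r.
Proof.
elim: K => [|K [r IH]].
  by exists 0; rewrite big_ord0 !expr0 mulr0 !mulr1 mul1r add0r addr0.
set c := b * q ^+ K.*2 in IH.
(* The error of the functional equation at [c], times the coefficient accumulated so far. *)
exists (r - (- b) ^+ K * q ^+ (K ^ 2) * (c ^+ 2 * Qrem q N.+1 c)).
have -> : b * q ^+ K.+1.*2 = c * q ^+ 2 by rewrite doubleS -addn2 exprD mulrA.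
have -> : (K.+1 ^ 2 = K ^ 2 + K.*2.+1)%N by rewrite -!mulnn -addnn; ring.
rewrite IH Qgen_functional_eq.
set F := Qgen _ _ _; set G := Qrem _ _ _.
rewrite big_ord_recr /= exprD !exprS /c; ring.
Qed.

(** The outer variable is [q], the inner one [a]. The empty sequence must be excluded explicitly,
    since the default [0] of [last] is even. *)
Definition Q_term (l : seq nat) : {poly {poly int}} :=
  if (l != [::]) && ~~ odd (last 0%N l) then (omega_e l)%:P * 'X^(sumn l) else 0.

Lemma Q_term_cons (x : nat) (l : seq nat) : l != [::] ->
  Q_term (x :: l) = - (('X ^+ odd x)%:P * 'X^x) * Q_term l.
Proof.
case: l => // y l _; rewrite /Q_term /=; case: ifP => _; last by rewrite mulr0.
rewrite /omega_e /= /nb_odd_parts /= !exprD exprS !polyCM polyCN.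
ring.
Qed.

Lemma sum_Q_term_rec (M : nat) :
  \sum_(l <- decseqs M.+1) Q_term l =
    (1 - ('X ^+ odd M)%:P * 'X^M) * \sum_(l <- decseqs M) Q_term l
    + (if odd M then 0 else 'X^M).
Proof.
rewrite /= big_cat big_map /= mulrBl mul1r -addrA; congr (_ + _).
have nil_in : [::] \in decseqs M by rewrite mem_decseqs.
(* The empty tail is split off: it yields the one-part sequence [[:: M]], hence the extra term for
   even [M]. *)
rewrite !(bigD1_seq [::]) ?decseqs_uniq //= [Q_term [::]]/Q_term /= add0r addrC.
congr (_ + _).
  by rewrite -mulNr mulr_sumr; apply: eq_bigr => l /Q_term_cons.
rewrite /Q_term /omega_e /nb_odd_parts /= addn0 addn0.
by case: (odd M) => //=; rewrite !expr0 mulr1 mul1r.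
Qed.

Lemma sum_Q_termE (N : nat) :
  \sum_(l <- decseqs N.*2) Q_term l = Qgen 'X N 'X%:P.
Proof.
elim: N => [|N IH]; first by rewrite /= big_seq1.
rewrite doubleS !sum_Q_term_rec IH /= odd_double /= !expr0 expr1 addr0.
by rewrite mul1r.
Qed.

Lemma coef_Q_term (n : nat) (l : seq nat) : sorted gtn l ->
  (Q_term l)`_n = if is_Q n l then omega_e l else 0.
Proof.
move=> sl; rewrite /Q_term /is_Q sl /=.
case: (l != [::]) => /=; last by rewrite coef0.
case: (odd _) => /=; first by rewrite coef0 andbF.
rewrite andbT coefCM coefXn eq_sym.
by case: ifP; rewrite ?mulr1 ?mulr0.
Qed.

Lemma sum_omega_e (n : nat) :
  \sum_(l : Q n) omega_e l = \sum_(k < n.+1 | n == (k ^ 2)%N) (- 'X) ^+ k.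
Proof.
have nM : (n < n.+1.*2)%N by rewrite -addnn leq_addr.
rewrite (sum_Q_decseqs omega_e _ _ nM) big_mkcond.
transitivity (\sum_(l <- decseqs n.+1.*2) Q_term l)`_n.
  rewrite coef_sum [LHS]big_seq [RHS]big_seq; apply: eq_bigr => l.
  by rewrite mem_decseqs => /andP[sl _]; rewrite coef_Q_term.
(* With [K = n.+1] the two remainders are multiples of [q ^+ (n.+1 ^ 2)] and [q ^+ n.+2.*2], so
   neither reaches degree [n]. *)
rewrite sum_Q_termE; have [r ->] := Qgen_theta ('X : {poly {poly int}}) n 'X%:P n.+1.
rewrite !coefD coefXnM.
have -> : (n < n.+2.*2)%N by rewrite (ltn_trans nM) // ltn_double.
rewrite -mulrA mulrCA coefXnM.
have -> : (n < n.+1 ^ 2)%N by rewrite -mulnn leq_pmulr.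
rewrite !addr0 coef_sum [RHS]big_mkcond; apply: eq_bigr => k _ /=.
by rewrite -polyCN -rmorphXn /= coefCM coefXn; case: ifP; rewrite ?mulr1 ?mulr0.
Qed.

Theorem theorem6p1 (n : nat) :
  (forall k : nat, n = (k ^ 2)%N ->
     \sum_(l : Q n) omega_e l = (- 'X) ^+ k :> {poly int}) /\
  ((forall k : nat, n <> (k ^ 2)%N) ->
     \sum_(l : Q n) omega_e l = 0 :> {poly int}).
Proof.
rewrite sum_omega_e; split=> [k nk|nsq]; last first.
  by rewrite big_pred0 // => k; apply/eqP/nsq.
have kn : (k < n.+1)%N by rewrite ltnS nk -mulnn; case: (k) => // j; rewrite leq_pmulr.
rewrite (big_pred1 (Ordinal kn)) // => i.
(* The type of [i] depends on [n], so [n] is replaced only as the left operand of the equality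
   test. *)
by rewrite [LHS](congr1 (eq_op^~ _) nk) eqn_exp2r // eq_sym.
Qed.
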